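(* Let $(S,\tau)$ be a topological inverse semigroup, let $\theta\colon S\to H(1_S)$ be a continuous homomorphism, and let $(\mathscr{B}(S,\mathbb{Z},\theta),\tau_{\mathbf{BR}})$ be a topological $\mathbb{Z}$-Bruck-Reilly extension of $(S,\tau)$ in the class of topological inverse semigroups. If the band $E(S)$ contains a minimal idempotent, then $\tau_{\mathbf{BR}}$ is the direct sum topology $\tau_{\mathbf{BR}}^{\mathbf{ds}}$ on $\mathscr{B}(S,\mathbb{Z},\theta)$.
   Context: All topological spaces are Hausdorff. A topological inverse semigroup is a (Hausdorff) topological space with a jointly continuous inverse-semigroup operation and continuous inversion. $E(S)$ denotes the set of idempotents of $S$, ordered by $e\leqslant f$ iff $ef=fe=e$. Convention: $S$ always has a unit $1_S$; a semigroup without unit is replaced by the monoid $S^1$ obtained by adjoining an isolated unit, so $S=S^1$. $H(1_S)$ is the group of units of $S$, with the subspace topology. For a homomorphism $\theta\colon S\to H(1_S)$ let $\theta^n$ be its $n$-fold composition, $\theta^0=\mathrm{id}_S$. The $\mathbb{Z}$-Bruck-Reilly extension $\mathscr{B}(S,\mathbb{Z},\theta)$ is the set $\mathbb{Z}\times S\times\mathbb{Z}$ with the semigroup operation $$(i,s,j)\cdot(m,t,n)=\begin{cases}(i-j+m,\theta^{m-j}(s)\cdot t,n), & j<m,\\ (i,s\cdot t,n), & j=m,\\ (i,s\cdot\theta^{j-m}(t),n-m+j), & j>m.\end{cases}$$ For $m,n\in\mathbb{Z}$ put $S_{m,n}=\{(m,s,n)\colon s\in S\}$. The direct sum topology $\tau_{\mathbf{BR}}^{\mathbf{ds}}$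 is the product topology on $\mathbb{Z}\times S\times\mathbb{Z}$ with $\mathbb{Z}$ discrete, i.e. the topology with base $\{\{i\}\times U\times\{j\}\colon U\in\tau,\ i,j\in\mathbb{Z}\}$. A topological $\mathbb{Z}$-Bruck-Reilly extension of $(S,\tau)$ in a class $\mathfrak{S}$ of semitopological semigroups (with $(S,\tau)\in\mathfrak{S}$) is a semigroup $(\mathscr{B}(S,\mathbb{Z},\theta),\tau_{\mathbf{BR}})\in\mathfrak{S}$, where $\theta$ is continuous and, for some $m\in\mathbb{Z}$, the restriction of $\tau_{\mathbf{BR}}$ to $S_{m,m}$ coincides with $\tau$ under the identification $(m,s,m)\leftrightarrow s$. *)

(* Defs.v *)
From HB Require Import structures.
From mathcomp Require Import all_boot all_order all_algebra.
From mathcomp Require Import all_classical all_analysis.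

Set Implicit Arguments.
Unset Strict Implicit.
Unset Printing Implicit Defensive.

Import Order.TTheory GRing.Theory Num.Theory.

Local Open Scope classical_set_scope.
Local Open Scope ring_scope.

(* No compatibility between product and topology is built in here. *)
#[short(type="topoMonoidType")]
HB.structure Definition TopoMonoid := {S of Monoid S & Topological S}.

Section InverseSemigroups.
Context {T : Type} (mul : T -> T -> T).

Definition semigroup_inverse (x y : T) : Prop :=
  mul (mul x y) x = x /\ mul (mul y x) y = y.

Definition inverse_semigroup : Prop :=
  associative mul /\ forall x, exists! y, semigroup_inverse x y.

(* The band E(S) and its natural partial order. *)
Definition idempotents : set T := [set e | mul e e = e].

Definition idem_le (e f : T) : Prop := mul e f = e /\ mul f e = e.

Definition minimal_idempotent (e : T) : Prop :=
  idempotents e /\ forall f, idempotents f -> idem_le f e -> f = e.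

End InverseSemigroups.

Definition topological_inverse_semigroup
    (T : topologicalType) (mul : T -> T -> T) : Prop :=
  [/\ hausdorff_space T,
      inverse_semigroup mul,
      continuous (fun p : T * T => mul p.1 p.2) &
      exists2 inv : T -> T,
        forall x, semigroup_inverse mul x (inv x) & continuous inv].

(* H(1_S); coerced to a type it carries the subspace topology. *)
Definition unit_group (S : topoMonoidType) : set S :=
  [set x | exists y, (x * y = 1)%g /\ (y * x = 1)%g].

Arguments unit_group : clear implicits.

Section BruckReilly.
Context {S : topoMonoidType}.
Implicit Type theta : S -> unit_group S.

Definition unit_hom theta : Prop :=
  forall s t, set_val (theta (s * t)%g)
            = (set_val (theta s) * set_val (theta t))%g.

Definition theta_iter theta (n : nat) : S -> S :=
  iter n (fun s => set_val (theta s)).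

(* The carrier of B(S, Z, theta), kept separate from the bare product so that
   it has no canonical topology. *)
Definition bruck_reilly theta : Type := (int * S * int)%type.

Definition br_mul theta (x y : bruck_reilly theta) : bruck_reilly theta :=
  let: (i, s, j) := x in
  let: (m, t, n) := y in
  if j < m then (i - j + m, (theta_iter theta `|m - j|%N s * t)%g, n)
  else if j == m then (i, (s * t)%g, n)
  else (i, (s * theta_iter theta `|j - m|%N t)%g, n - m + j).

Definition br_diag theta (m : int) (s : S) : bruck_reilly theta := (m, s, m).

(* A topology on B(S, Z, theta) is an element of [Topological _];
   [br_space tau] is the resulting topological space. *)
Definition br_space theta (tau : Topological (bruck_reilly theta)) :
  topologicalType := Topological.Pack tau.

(* The direct sum topology: the product topology with both factors Z
   discrete. *)
Definition ds_space : topologicalType :=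
  (discrete_topology int * S * discrete_topology int)%type.

(* [C] is the ambient class of semitopological semigroups; the initial topology
   along [br_diag theta m] is the restriction of tau to S_{m,m} under the
   identification (m, s, m) <-> s. *)
Definition topological_BR_extension
    (C : forall T : topologicalType, (T -> T -> T) -> Prop)
    theta (tau : Topological (bruck_reilly theta)) : Prop :=
  [/\ C S (fun s t => s * t)%g,
      C (br_space tau) (@br_mul theta),
      continuous theta &
      exists m : int, forall U : set S,
        open U <->
        @open (initial_topology (br_diag theta m : S -> br_space tau)) U].

End BruckReilly.

(* Main.v *)
Require Import Defs.
From HB Require Import structures.
From mathcomp Require Import all_boot all_order all_algebra.
From mathcomp Require Import all_classical all_analysis.

(** Write [x = (i, s, j)] for an element of the extension.  Since
    [x x^-1 = (i, s s^-1, i)], the row index [i] of [x] is read off from the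
    position of an idempotent, and the idempotents [(i, e, i)] form a chain of
    copies of [E(S)] that decreases as [i] grows, because [theta] sends every
    idempotent to [1].

    Rows [>= i] form the closed set [{x | (i, 1, i) x = x}]
    ([closed_br_row_ge]).  A minimal idempotent [e] of [S] is the least one, so
    [(i, e, i)] lies below [x x^-1] exactly when the row of [x] is [<= i]; by
    continuity of multiplication and inversion, rows [<= i] form a closed set as
    well ([closed_br_row_le]).  This is where the minimal idempotent enters: an
    idempotent cuts the chain exactly between rows [i] and [i + 1] only if it is
    the least one of row [i].  Hence every row is open ([open_br_row]), and by
    applying the inversion, which exchanges rows and columns, so is every column:
    all the blocks [S_{i,j}] are open.

    Finally [S_{i,j}] and [S_{m,m}] are exchanged by two-sided translations
    ([br_mul_block]), which are continuous and mutually inverse.  The copy of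
    [S] on [S_{m,m}] therefore determines the topology on every block, and it
    does so as in the direct sum topology. *)

Set Implicit Arguments.
Unset Strict Implicit.
Unset Printing Implicit Defensive.

Import Order.TTheory GRing.Theory Num.Theory.

Local Open Scope classical_set_scope.
Local Open Scope ring_scope.

(** * Idempotents of inverse semigroups *)

Section InverseSemigroupIdempotents.
Context {T : Type} (mul : T -> T -> T) (mulT : inverse_semigroup mul).

Local Lemma mulTA : associative mul. Proof. exact: mulT.1. Qed.

Lemma semigroup_inverse_uniq x y z :
  semigroup_inverse mul x y -> semigroup_inverse mul x z -> y = z.
Proof. by case: (mulT.2 x) => w [_ u] /u <- /u. Qed.

Lemma semigroup_inverse_sym x y :
  semigroup_inverse mul x y -> semigroup_inverse mul y x.
Proof. by case. Qed.

Lemma idempotent_self_inverse e :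
  idempotents mul e -> semigroup_inverse mul e e.
Proof. by rewrite /idempotents /= => ee; split; rewrite !ee. Qed.

(** If [x] is the inverse of [ef], then [fxe] is an idempotent which is again an
    inverse of [ef]; being also inverse to itself, it equals [ef]. *)
Lemma idempotentM e f :
  idempotents mul e -> idempotents mul f -> idempotents mul (mul e f).
Proof.
rewrite /idempotents /= => ee ff.
case: (mulT.2 (mul e f)) => x [[efx xef] _].
have inv_fxe : semigroup_inverse mul (mul e f) (mul f (mul x e)).
  split.
    rewrite -[RHS]efx !mulTA.
    by rewrite -(mulTA e f f) ff -(mulTA _ e e) ee.
  rewrite -[in RHS]xef !mulTA.
  by rewrite -(mulTA _ e e) ee -(mulTA _ f f) ff.
have fxe_idem : idempotents mul (mul f (mul x e)).
  by rewrite /idempotents /= -[in RHS]xef !mulTA.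
have -> : mul e f = mul f (mul x e); last exact: fxe_idem.
exact: semigroup_inverse_uniq (semigroup_inverse_sym inv_fxe)
         (idempotent_self_inverse fxe_idem).
Qed.

(** Both [fe] and [ef] are inverses of the idempotent [ef]. *)
Lemma idempotentC e f :
  idempotents mul e -> idempotents mul f -> mul e f = mul f e.
Proof.
move=> ee ff.
have ef := idempotentM ee ff; have fe := idempotentM ff ee.
apply: semigroup_inverse_uniq (idempotent_self_inverse ef) _.
move: ee ff ef fe; rewrite /idempotents /= => ee ff ef fe; split.
  by rewrite -[RHS]ef !mulTA -(mulTA e f f) ff -(mulTA _ e e) ee.
by rewrite -[RHS]fe !mulTA -(mulTA f e e) ee -(mulTA _ f f) ff.
Qed.

(** In a semilattice a minimal element is the least one. *)
Lemma minimal_idempotent_least e f :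
  minimal_idempotent mul e -> idempotents mul f -> mul e f = e.
Proof.
move=> [ee emin] ff; apply: emin; first exact: idempotentM.
move: (ee); rewrite /idempotents /idem_le /= => ee'; split.
  by rewrite (idempotentC ee ff) -mulTA ee'.
by rewrite mulTA ee'.
Qed.

Lemma mul_inverse_idempotent x y :
  semigroup_inverse mul x y -> idempotents mul (mul x y).
Proof. by case=> xyx _; rewrite /idempotents /= mulTA xyx. Qed.

End InverseSemigroupIdempotents.

(** * Equalizers and translations *)

Lemma closed_equalizer (X Y : topologicalType) (f g : X -> Y) :
  hausdorff_space Y -> continuous f -> continuous g ->
  closed [set x | f x = g x].
Proof.
move=> hY cf cg x clx; apply: hY => A B Afx Bgx.
have Ax : nbhs x (f @^-1` A) := cf x A Afx.
have Bx : nbhs x (g @^-1` B) := cg x B Bgx.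
have [y [fgy [Ay By]]] := clx _ (filterI Ax Bx).
by exists (f y); split => //; rewrite fgy.
Qed.

Section Translations.
Context {X T : topologicalType} (mul : T -> T -> T).
Hypothesis mul_cont : continuous (fun p : T * T => mul p.1 p.2).

Lemma continuous_mul (f g : X -> T) :
  continuous f -> continuous g -> continuous (fun x => mul (f x) (g x)).
Proof.
move=> cf cg x.
by apply: continuous2_cvg; [exact: (@mul_cont (f x, g x))|exact: cf|exact: cg].
Qed.

End Translations.

(** * Algebra of the extension *)

#[local] Arguments br_mul : simpl never.

Section BruckReillyAlgebra.
Context {S : topoMonoidType} (theta : S -> unit_group S).
Hypothesis theta_hom : unit_hom theta.
Local Notation smul := (fun s t : S => (s * t)%g).
Local Notation B := (bruck_reilly theta).

(** The only idempotent of a group is its identity. *)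
Lemma theta_idempotent (e : S) :
  idempotents smul e -> set_val (theta e) = 1%g.
Proof.
rewrite /idempotents /= => ee.
have [y [+ _]] := set_valP (theta e); rewrite -[\val _]/(set_val _) => uy.
by rewrite -[RHS]uy -[in RHS]ee theta_hom -mulgA uy mulg1.
Qed.

Lemma theta_iter_idempotent n (e : S) :
  (0 < n)%N -> idempotents smul e -> theta_iter theta n e = 1%g.
Proof.
case: n => // n _ ee.
elim: n => [|n IHn]; first exact: theta_idempotent.
rewrite /theta_iter iterS -/(theta_iter theta n.+1 e) IHn.
by apply: theta_idempotent; rewrite /idempotents /= mulg1.
Qed.

Lemma br_mul_eq (i j n : int) (s t : S) :
  br_mul ((i, s, j) : B) (j, t, n) = (i, (s * t)%g, n).
Proof. by rewrite /br_mul ltxx eqxx. Qed.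

Lemma br_mul_idempotent_lt (i m n : int) (e s : S) :
  idempotents smul e -> i < m ->
  br_mul ((i, e, i) : B) (m, s, n) = (m, s, n).
Proof.
move=> ee im; rewrite /br_mul im theta_iter_idempotent ?mul1g //.
  by rewrite subrr add0r.
by rewrite absz_gt0 subr_eq0 gt_eqF.
Qed.

Lemma br_mul_idempotent_gt (i m : int) (e f : S) :
  idempotents smul f -> m < i ->
  br_mul ((i, e, i) : B) (m, f, m) = (i, e, i).
Proof.
move=> ff mi; rewrite /br_mul ltNge (ltW mi) /= gt_eqF //.
rewrite theta_iter_idempotent ?mulg1 ?subrr ?add0r //.
by rewrite absz_gt0 subr_eq0 gt_eqF.
Qed.

Lemma br_mul_block (i j k l : int) (s : S) :
  br_mul (br_mul ((k, 1%g, i) : B) (i, s, j)) (j, 1%g, l) = (k, s, l).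
Proof. by rewrite !br_mul_eq mul1g mulg1. Qed.

Lemma br_inverse (i j : int) (s t : S) :
  semigroup_inverse smul s t ->
  semigroup_inverse (@br_mul S theta) (i, s, j) (j, t, i).
Proof. by move=> [/= sts tst]; split; rewrite !br_mul_eq ?sts ?tst. Qed.

End BruckReillyAlgebra.

(** * Openness of the blocks *)

Section OpenBlocks.
Context {S : topoMonoidType} (theta : S -> unit_group S).
Context (tau : Topological (bruck_reilly theta)).
Hypothesis theta_hom : unit_hom theta.
Local Notation smul := (fun s t : S => (s * t)%g).
Local Notation B := (br_space tau).
Local Notation bmul := (@br_mul S theta).
Hypothesis smulI : inverse_semigroup smul.
Hypothesis hausB : hausdorff_space B.
Hypothesis bmulI : inverse_semigroup bmul.
Hypothesis bmul_cont : continuous (fun p : B * B => bmul p.1 p.2 : B).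
Context (inv : B -> B).
Hypothesis invP : forall x, semigroup_inverse bmul x (inv x).
Hypothesis inv_cont : continuous inv.
Context (e : S) (emin : minimal_idempotent smul e).

Lemma br_invE (i j : int) (s : S) :
  exists2 t, semigroup_inverse smul s t & inv (i, s, j) = (j, t, i).
Proof.
have [t [st _]] := smulI.2 s; exists t => //.
exact: (semigroup_inverse_uniq bmulI (invP (i, s, j)) (br_inverse theta i j st)).
Qed.

(** [(i, 1, i)] is a left identity exactly for the rows [>= i]: it raises every
    smaller row index to [i]. *)
Lemma closed_br_row_ge (i : int) : closed [set x : B | i <= x.1.1].
Proof.
have -> : [set x : B | i <= x.1.1] = [set x : B | bmul (i, 1%g, i) x = x].
  apply/seteqP; split=> [[[m s] n]|[[m s] n]] /=.
    rewrite le_eqVlt => /orP[/eqP <-|im]; first by rewrite br_mul_eq mul1g.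
    apply: br_mul_idempotent_lt => //.
    by rewrite /idempotents /= mulg1.
  case: (ltgtP i m) => // mi.
  by rewrite /br_mul ltNge (ltW mi) /= gt_eqF // => -[im]; rewrite im ltxx in mi.
apply: (@closed_equalizer B B (fun x => bmul (i, 1%g, i) x) id) => //.
- by apply: (continuous_mul bmul_cont) => x; [exact: cvg_cst|exact: cvg_id].
- by move=> x; exact: cvg_id.
Qed.

(** [x x^-1] lies in the row of [x], so it is above [(i, e, i)] when that row is
    smaller than [i], by leastness of [e] when the row is [i], and strictly below
    [(i, e, i)] when the row is larger. *)
Lemma closed_br_row_le (i : int) : closed [set x : B | x.1.1 <= i].
Proof.
have [ee _] := emin.
have -> : [set x : B | x.1.1 <= i] =
    [set x : B | bmul (i, e, i) (bmul x (inv x)) = (i, e, i)].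
  apply/seteqP; split=> [[[m s] n]|[[m s] n]];
    rewrite /mkset /=; have [t st ->] := br_invE m n s;
    have ff := mul_inverse_idempotent smulI st; rewrite br_mul_eq.
    rewrite le_eqVlt => /orP[/eqP ->|mi].
      by rewrite br_mul_eq (minimal_idempotent_least smulI emin ff).
    exact: br_mul_idempotent_gt.
  case: (leP m i) => // im.
  by rewrite br_mul_idempotent_lt // => -[mi]; rewrite mi ltxx in im.
apply: (@closed_equalizer B B (fun x => bmul (i, e, i) (bmul x (inv x)))
  (fun=> (i, e, i))) => //; last by move=> x; exact: cvg_cst.
apply: (continuous_mul bmul_cont); first by move=> x; exact: cvg_cst.
by apply: (continuous_mul bmul_cont) => // x; exact: cvg_id.
Qed.

Lemma open_br_row (i : int) : open [set x : B | x.1.1 = i].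
Proof.
have -> : [set x : B | x.1.1 = i] =
    ~` [set x : B | i + 1 <= x.1.1] `&` ~` [set x : B | x.1.1 <= i - 1].
  apply/seteqP; split=> x /=.
    by move=> ->; split; apply/negP; rewrite -ltNge ?ltrDl // ltrBlDr ltrDl.
  case=> /negP + /negP; rewrite -!ltNge ltzD1 ltrBlDr ltzD1 => xi ix.
  by apply/eqP; rewrite eq_le xi ix.
by apply: openI; apply: closed_openC;
  [exact: closed_br_row_ge|exact: closed_br_row_le].
Qed.

Lemma open_br_column (j : int) : open [set x : B | x.2 = j].
Proof.
have -> : [set x : B | x.2 = j] = inv @^-1` [set x : B | x.1.1 = j].
  by apply/seteqP; split=> -[[m s] n] /=; have [t _ ->] := br_invE m n s.
by move/continuousP: inv_cont; apply; exact: open_br_row.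
Qed.

Lemma open_br_block (i j : int) :
  open [set x : B | x.1.1 = i /\ x.2 = j].
Proof. by apply: openI; [exact: open_br_row|exact: open_br_column]. Qed.

End OpenBlocks.

(** * The direct sum topology *)

(** Both index factors being discrete, every point of the product has
    arbitrarily small neighbourhoods inside its own block. *)
Lemma open_ds_slices (S : topoMonoidType) (A : set (int * S * int)) :
  @open (@ds_space S) A <-> forall i j, open [set s : S | A (i, s, j)].
Proof.
split=> [Ao i j|slices].
  have cf : continuous (fun s : S => ((i, s, j) : @ds_space S)).
    move=> s; apply: (@cvg_pair _ _ _ _ (nbhs ((i, s) : discrete_topology int * S))
      (nbhs (j : discrete_topology int))).
      apply: (@cvg_pair _ _ _ _ (nbhs (i : discrete_topology int)) (nbhs s)).
        exact: cvg_cst.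
      exact: cvg_id.
    exact: cvg_cst.
  by move/continuousP: cf => /(_ _ Ao).
rewrite openE => -[[i s] j] As.
have As_nbhs : nbhs s [set s : S | A (i, s, j)].
  exact: open_nbhs_nbhs.
exists ([set y : discrete_topology int * S | y.1 = i /\ A (i, y.2, j)],
        [set j : discrete_topology int]).
  split=> /=; last exact: discrete_set1.
  exists ([set i : discrete_topology int], [set s : S | A (i, s, j)]).
    by split=> //=; exact: discrete_set1.
  by move=> [i' s'] /= [->].
by move=> [[i' s'] j'] /= [[-> ?] ->].
Qed.

Theorem theorem2p6 (S : topoMonoidType) (theta : S -> unit_group S)
  (tau : Topological (bruck_reilly theta))
  (hS : topological_inverse_semigroup (fun s t : S => s * t)%g)
  (theta_hom : unit_hom theta) (theta_cont : continuous theta)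
  (htau : topological_BR_extension topological_inverse_semigroup tau)
  (hmin : exists e : S, minimal_idempotent (fun s t : S => s * t)%g e) :
  forall A : set (int * S * int), @open (br_space tau) A <-> @open (@ds_space S) A.
Proof.
case: hS => _ smulI _ _.
case: htau => _ [hausB bmulI bmul_cont [inv invP inv_cont]] _ [m diagE].
case: hmin => e emin A.
(* Carries [S_{i,j}] onto [S_{k,l}], keeping the middle component. *)
pose block_map k l i j (x : br_space tau) : br_space tau :=
  br_mul (br_mul (k, 1%g, i) x) (j, 1%g, l).
have block_map_cont k l i j : continuous (block_map k l i j).
  apply: (continuous_mul bmul_cont); last by move=> x; exact: cvg_cst.
  by apply: (continuous_mul bmul_cont) => x; [exact: cvg_cst|exact: cvg_id].
apply: iff_trans (iff_sym (open_ds_slices A)); split=> [Ao i j|slices].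
  apply/diagE; exists (block_map i j m m @^-1` A).
    by move/continuousP: (block_map_cont i j m m); apply.
  by apply/seteqP; split=> s; rewrite /preimage /= /block_map br_mul_block.
have -> : A = \bigcup_(p : int * int)
    ([set x | x.1.1 = p.1 /\ x.2 = p.2] `&`
     [set x | A (p.1, x.1.2, p.2)]).
  apply/seteqP; split=> [[[i s] j] As|[[i s] j] [[k l] _ /= [[-> ->]]]] //.
  by exists (i, j).
apply: (@bigcup_open (br_space tau)) => -[i j] _ /=.
have /diagE[V Vo VE] := slices i j.
(* On the block [S_{i,j}] the trace of [A] is the trace of a translate of [V]. *)
have -> : [set x : br_space tau | x.1.1 = i /\ x.2 = j] `&`
      [set x | A (i, x.1.2, j)] =
    [set x : br_space tau | x.1.1 = i /\ x.2 = j] `&`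
      (block_map m m i j @^-1` V).
  apply/seteqP; split=> -[[k s] l] [/= [-> ->]];
    rewrite /preimage /= /block_map br_mul_block => h; split=> //.
    by have : [set s | A (i, s, j)] s by []; rewrite -VE.
  by have : (br_diag theta m @^-1` V) s by []; rewrite VE.
apply: openI; first exact: (open_br_block theta_hom smulI hausB bmulI bmul_cont
                             invP inv_cont emin).
by move/continuousP: (block_map_cont m m i j); apply.
Qed.
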